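(* Two matroids $\mathsf{M}_1$ and $\mathsf{M}_2$ are isomorphic to each other if and only if $$|\operatorname{Hom}(\mathsf{M}_1,\mathsf{L})| = |\operatorname{Hom}(\mathsf{M}_2,\mathsf{L})|$$ for all matroids $\mathsf{L}$.
   Context: Matroids have nonempty finite ground sets; $E(\mathsf{M})$ denotes the ground set of $\mathsf{M}$. An isomorphism of matroids is a bijection of ground sets under which a set is a basis if and only if its image is a basis. Let $\mathsf{U}(0,e)$ be the rank-$0$ matroid on the one-element set $\{e\}$ (so $e$ is a loop). A strong map $\varphi:\mathsf{M}_1\to\mathsf{M}_2$ is a function $\varphi:E(\mathsf{M}_1)\sqcup\{e\}\to E(\mathsf{M}_2)\sqcup\{e\}$ such that $\varphi(e)=e$ and the inverse image of every flat of $\mathsf{M}_2\oplus\mathsf{U}(0,e)$ is a flat of $\mathsf{M}_1\oplus\mathsf{U}(0,e)$. $\operatorname{Hom}(\mathsf{M}_1,\mathsf{M}_2)$ denotes the set of strong maps $\mathsf{M}_1\to\mathsf{M}_2$. *)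

(* Defs.v *)
From mathcomp Require Import all_boot.

Set Implicit Arguments.
Unset Strict Implicit.
Unset Printing Implicit Defensive.

Record matroid := Matroid {
  ground : finType;
  bases : {set {set ground}};
  ground_nonempty : 0 < #|ground|;
  bases_nonempty : bases != set0;
  bases_exchange : forall B1 B2, B1 \in bases -> B2 \in bases ->
    forall x, x \in B1 :\: B2 ->
    exists2 y, y \in B2 :\: B1 & y |: (B1 :\ x) \in bases }.

Section Flats.
Variable M : matroid.

Definition indep (A : {set ground M}) : bool :=
  [exists B in bases M, A \subset B].

Definition rank (A : {set ground M}) : nat :=
  \max_(I : {set ground M} | indep I && (I \subset A)) #|I|.

Definition closure (A : {set ground M}) : {set ground M} :=
  [set x | rank (x |: A) == rank A].

Definition flat (A : {set ground M}) : bool := closure A == A.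

End Flats.

Section DirectSum.
Variables M N : matroid.

Definition dsum_ground : finType := (ground M + ground N)%type.

Definition dsum_set (B : {set ground M}) (C : {set ground N})
    : {set dsum_ground} :=
  (inl @: B) :|: (inr @: C).

Definition dsum_bases : {set {set dsum_ground}} :=
  [set dsum_set B C | B in bases M, C in bases N].

Lemma mem_dsum_set_inl (B : {set ground M}) (C : {set ground N}) x :
  (inl x \in dsum_set B C) = (x \in B).
Proof.
rewrite in_setU mem_imset; last by move=> ? ? [].
by case: imsetP => [[]|] //; rewrite orbF.
Qed.

Lemma mem_dsum_set_inr (B : {set ground M}) (C : {set ground N}) x :
  (inr x \in dsum_set B C) = (x \in C).
Proof.
rewrite in_setU orbC mem_imset; last by move=> ? ? [].
by case: imsetP => [[]|] //; rewrite orbF.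
Qed.

Lemma dsum_ground_nonempty : 0 < #|dsum_ground|.
Proof. by rewrite card_sum addn_gt0 ground_nonempty. Qed.

Lemma dsum_bases_nonempty : dsum_bases != set0.
Proof.
have /set0Pn [B hB] := bases_nonempty M.
have /set0Pn [C hC] := bases_nonempty N.
by apply/set0Pn; exists (dsum_set B C); apply: imset2_f.
Qed.

Lemma dsum_bases_exchange D1 D2 : D1 \in dsum_bases -> D2 \in dsum_bases ->
  forall x, x \in D1 :\: D2 ->
  exists2 y, y \in D2 :\: D1 & y |: (D1 :\ x) \in dsum_bases.
Proof.
case/imset2P=> B1 C1 hB1 hC1 -> /imset2P[B2 C2 hB2 hC2 ->] [x|x];
  rewrite in_setD ?mem_dsum_set_inl ?mem_dsum_set_inr -in_setD => hx.
- have [y hy hB] := bases_exchange hB1 hB2 hx.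
  exists (inl y); first by rewrite in_setD !mem_dsum_set_inl -in_setD.
  rewrite (_ : _ |: _ = dsum_set (y |: (B1 :\ x)) C1);
    first exact: imset2_f.
  by apply/setP=> -[z|z]; rewrite ?mem_dsum_set_inl ?mem_dsum_set_inr in_setU1 in_setD1
    ?mem_dsum_set_inl ?mem_dsum_set_inr // in_setU1 in_setD1.
- have [y hy hC] := bases_exchange hC1 hC2 hx.
  exists (inr y); first by rewrite in_setD !mem_dsum_set_inr -in_setD.
  rewrite (_ : _ |: _ = dsum_set B1 (y |: (C1 :\ x)));
    first exact: imset2_f.
  by apply/setP=> -[z|z]; rewrite ?mem_dsum_set_inl ?mem_dsum_set_inr in_setU1 in_setD1
    ?mem_dsum_set_inl ?mem_dsum_set_inr // in_setU1 in_setD1.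
Qed.

Definition dsum : matroid :=
  Matroid dsum_ground_nonempty dsum_bases_nonempty dsum_bases_exchange.

End DirectSum.

Lemma loop_ground_nonempty : 0 < #|{: unit}|.
Proof. by rewrite card_unit. Qed.

Lemma loop_bases_nonempty : [set set0] != set0 :> {set {set unit}}.
Proof. by apply/set0Pn; exists set0; rewrite set11. Qed.

Lemma loop_bases_exchange (B1 B2 : {set unit}) :
  B1 \in [set set0] -> B2 \in [set set0] ->
  forall x, x \in B1 :\: B2 ->
  exists2 y, y \in B2 :\: B1 & y |: (B1 :\ x) \in [set set0].
Proof. by move=> /set1P-> _ x; rewrite in_setD in_set0 andbF. Qed.

(* U(0,e), with e the element tt of unit *)
Definition loop_matroid : matroid :=
  Matroid loop_ground_nonempty loop_bases_nonempty loop_bases_exchange.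

Definition pointed (M : matroid) : matroid := dsum M loop_matroid.

Definition pt (M : matroid) : ground (pointed M) := inr tt.

Definition strong_map (M N : matroid)
    (phi : {ffun ground (pointed M) -> ground (pointed N)}) : bool :=
  (phi (pt M) == pt N) &&
  [forall F : {set ground (pointed N)},
     @flat (pointed N) F ==> @flat (pointed M) (phi @^-1: F)].

Definition Hom (M N : matroid)
    : {set {ffun ground (pointed M) -> ground (pointed N)}} :=
  [set phi | strong_map phi].

Definition isomorphic (M N : matroid) : Prop :=
  exists2 f : ground M -> ground N, bijective f &
    forall B : {set ground M}, (B \in bases M) = (f @: B \in bases N).

(* Main.v *)
Require Import Defs.
From mathcomp Require Import all_boot.
(* Otherwise closure would denote the closure of a set under a relation. *)
Import Defs.

(** Lovasz's argument that an object is determined by counting morphisms out of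
it, carried out in the category of pointed matroids and strong maps.

If M1 and M2 have the same number of strong maps into every matroid, fix a
matroid L and sort the strong maps into L by support, that is, by the set of
non-distinguished points of L that they hit. Strong maps with support inside S
are the strong maps into the restriction of L to S, because the flats of a
restriction are exactly the traces of the flats of L
([card_Hom_embedding]); for S empty, when the restriction is not a matroid with
nonempty ground set, only the constant map is left ([card_Hom_supp0]).
Subtracting the contributions of the proper subsets of S, induction on the size
of S shows that M1 and M2 have the same number of strong maps with support
exactly S ([card_Hom_supp_eq]). For L = M1 and S the whole ground set, the
identity shows that this number is positive, so there is a surjective strong
map from M2 to M1, and by symmetry one from M1 to M2.

Two such surjections are bijections, since the ground sets are finite. Taking
preimages under them injects the flats of each pointed matroid into the flats
of the other, so these finite families have the same size and both injections
are onto: each map matches the flats exactly ([strong_surjections_flat]).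
The flats determine the independent sets ([indep_flatP]), hence the bases, so
the map is an isomorphism of the pointed matroids; it fixes the distinguished
loop and therefore restricts to an isomorphism of M1 and M2.

Conversely, an isomorphism extends to the pointed matroids, and precomposition
with it injects one Hom set into the other, in both directions.

The flats are related to the bases through rank and independence. Restrictions,
the inclusion of a matroid in its pointed version, and isomorphisms are all
instances of one notion, an injective map that preserves and reflects
independence ([embedding]); the flats of its source are the preimages of the
flats of its target ([embedding_flat]). *)

Set Implicit Arguments.
Unset Strict Implicit.
Unset Printing Implicit Defensive.

(** * Bases, independence, rank and closure *)

Lemma card_swap (T : finType) (A : {set T}) x y :
  x \in A -> y \notin A -> #|y |: (A :\ x)| = #|A|.
Proof.
move=> xA yA; rewrite cardsU1 in_setD1 (negPf yA) andbF /=.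
by rewrite [RHS](cardsD1 x) xA.
Qed.

Section MatroidTheory.
Variable M : matroid.
Implicit Types (A B I J : {set ground M}) (x y : ground M).

Lemma indepP A :
  reflect (exists2 B, B \in bases M & A \subset B) (indep A).
Proof. exact: exists_inP. Qed.

Lemma indepS A B : A \subset B -> indep B -> indep A.
Proof.
move=> sAB /indepP[C hC sBC].
by apply/indepP; exists C => //; apply: subset_trans sBC.
Qed.

Lemma bases_indep B : B \in bases M -> indep B.
Proof. by move=> hB; apply/indepP; exists B. Qed.

Lemma indep0 : indep (set0 : {set ground M}).
Proof.
have /set0Pn[B hB] := bases_nonempty M.
by apply: indepS (bases_indep hB); apply: sub0set.
Qed.

(** Exchanging an element of B1 :\: B2 keeps the size of B1 and brings it
closer to B2. *)
Lemma bases_card B1 B2 : B1 \in bases M -> B2 \in bases M -> #|B1| = #|B2|.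
Proof.
move: {2}_.+1 (ltnSn #|B1 :\: B2|) => n.
elim: n B1 => // n IHn B1 ltn hB1 hB2.
have [/eqP s0 | [x hx]] := set_0Vmem (B1 :\: B2).
  have [e|[y hy]] := set_0Vmem (B2 :\: B1).
    move/eqP: e; rewrite setD_eq0 => s21; rewrite setD_eq0 in s0.
    by apply/eqP; rewrite eqn_leq !subset_leq_card.
  by have [z] := bases_exchange hB2 hB1 hy; rewrite (eqP s0) inE.
have [y hy hB] := bases_exchange hB1 hB2 hx.
move: (hx) (hy); rewrite !inE => /andP[xB2 xB1] /andP[yB1 yB2].
rewrite -(card_swap xB1 yB1); apply: IHn => //.
rewrite -ltnS; apply: leq_trans ltn; rewrite ltnS; apply: proper_card.
apply/properP; split; last by exists x; rewrite // !inE eqxx (negPf xB2) /=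
  orbF; case: eqP xB2 => // ->; rewrite yB2.
apply/subsetP => z; rewrite !inE.
by case: eqP => [->|_] /=; [rewrite yB2 | case/and3P => -> _ ->].
Qed.

(** Exchanging into B the elements of a basis containing I that lie outside
I :|: B never removes an element of I, and stops once no such element is
left. *)
Lemma bases_extend I B : indep I -> B \in bases M ->
  exists B', [/\ B' \in bases M, I \subset B' & B' \subset I :|: B].
Proof.
move=> /indepP[B1 hB1 sI] hB.
move: {2}_.+1 (ltnSn #|B1 :\: (I :|: B)|) => n.
elim: n B1 hB1 sI => // n IHn B1 hB1 sI ltn.
have [/eqP | [x hx]] := set_0Vmem (B1 :\: (I :|: B)).
  by rewrite setD_eq0 => s; exists B1.
move: (hx); rewrite !inE negb_or => /andP[/andP[xI xB] xB1].
have hxB : x \in B1 :\: B by rewrite !inE xB.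
have [y hy hB'] := bases_exchange hB1 hB hxB.
move: (hy); rewrite !inE => /andP[yB1 yB].
apply: IHn hB' _ _.
  apply/subsetP => z zI; rewrite !inE (subsetP sI z zI).
  by case: (eqVneq z x) zI => [->|_ _]; rewrite ?(negPf xI) ?orbT.
rewrite -ltnS; apply: leq_trans ltn; rewrite ltnS; apply: proper_card.
apply/properP; split; last first.
  exists x; rewrite // !inE eqxx (negPf xI) (negPf xB) /= orbF.
  by case: eqP xB => // ->; rewrite yB.
apply/subsetP => z; rewrite !inE.
by case: eqP => [->|_] /=; [rewrite yB orbT | case/and3P => -> _ ->].
Qed.

(** Complete I to a basis B' inside I :|: B, where B is a basis containing J. If
B' contained no element of J :\: I it would lie in I :|: (B :\: J), which is
smaller than B because I is smaller than J. *)
Lemma indep_augment I J : indep I -> indep J -> #|I| < #|J| ->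
  exists2 x, x \in J :\: I & indep (x |: I).
Proof.
move=> hI /indepP[B hB sJ] ltIJ.
have [B' [hB' sI sB']] := bases_extend hI hB.
have [e | [x]] := set_0Vmem (B' :&: (J :\: I)); last first.
  rewrite inE => /andP[xB' xJ]; exists x => //.
  by apply: indepS (bases_indep hB'); rewrite subUset sub1set xB'.
have s : B' \subset I :|: (B :\: J).
  apply/subsetP => z zB'; move/setP/(_ z): e (subsetP sB' z zB').
  by rewrite !inE zB' /=; case: (z \in I) => //=; case: (z \in J).
suff : #|B'| < #|B| by rewrite (bases_card hB' hB) ltnn.
apply: leq_ltn_trans (subset_leq_card s) _.
apply: leq_ltn_trans (leq_card_setU _ _) _.
by rewrite -(cardsID J B) (setIidPr sJ) ltn_add2r.
Qed.

Lemma rank_max I A : indep I -> I \subset A -> #|I| <= rank A.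
Proof.
by move=> hI sI; rewrite /rank (leq_bigmax_cond (F := fun I => #|I|)) // hI.
Qed.

Lemma rank_witness A : exists I, [/\ indep I, I \subset A & #|I| = rank A].
Proof.
have h0 : 0 < #|[pred I | indep I && (I \subset A)]|.
  by apply/card_gt0P; exists set0; rewrite inE indep0 sub0set.
have [I /andP[hI sI] e] := eq_bigmax_cond (fun I : {set ground M} => #|I|) h0.
by exists I; split => //; rewrite -e; apply: eq_bigl.
Qed.

Lemma rankS A B : A \subset B -> rank A <= rank B.
Proof.
move=> sAB; have [I [hI sI <-]] := rank_witness A.
by apply: rank_max => //; apply: subset_trans sAB.
Qed.

Lemma rank_indep I : indep I -> rank I = #|I|.
Proof.
move=> hI; apply/eqP; rewrite eqn_leq rank_max // andbT.
by have [J [_ sJ <-]] := rank_witness I; apply: subset_leq_card.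
Qed.

Lemma indep_extend I A : indep I -> I \subset A ->
  exists J, [/\ indep J, I \subset J, J \subset A & #|J| = rank A].
Proof.
move: {2}_.+1 (ltnSn (rank A - #|I|)) => n.
elim: n I => // n IHn I ltn hI sI.
case: (ltnP #|I| (rank A)) => [ltI | geI]; last first.
  by exists I; split => //; apply/eqP; rewrite eqn_leq geI rank_max.
have [K [hK sK eK]] := rank_witness A; rewrite -eK in ltI.
have [x] := indep_augment hI hK ltI; rewrite inE => /andP[xI xK] hxI.
have [||J [hJ sJ sJA eJ]] := IHn (x |: I) _ hxI _.
- rewrite cardsU1 xI /= -ltnS; apply: leq_trans ltn; rewrite ltnS -eK.
  by rewrite add1n subnSK.
- by rewrite subUset sub1set sI (subsetP sK).
by exists J; split => //; apply: subset_trans sJ; apply: subsetUr.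
Qed.

Lemma mem_bases B : (B \in bases M) = indep B && (#|B| == rank [set: ground M]).
Proof.
have eB C : C \in bases M -> #|C| = rank [set: ground M].
  move=> hC; have [I [/indepP[D hD sD] _ eI]] := rank_witness setT.
  apply/eqP; rewrite eqn_leq rank_max ?bases_indep ?subsetT //=.
  rewrite -eI (bases_card hC hD); exact: subset_leq_card.
apply/idP/andP => [hB | [/indepP[C hC sC] /eqP e]].
  by rewrite bases_indep // eB.
suff -> : B = C by [].
by apply/eqP; rewrite eqEcard sC e (eB C hC) leqnn.
Qed.

Lemma mem_closure A x : (x \in closure A) = (rank (x |: A) <= rank A).
Proof. by rewrite inE eqn_leq (rankS (subsetUr _ _)) andbT. Qed.

Lemma sub_closure A : A \subset closure A.
Proof.
by apply/subsetP => x xA; rewrite mem_closure (setUidPr _) // sub1set.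
Qed.

(** If x raised the rank of B, then x could be added to a maximal independent
subset J of B, hence also to a maximal independent subset of A contained in J,
and so x would raise the rank of A. *)
Lemma closureS A B : A \subset B -> closure A \subset closure B.
Proof.
move=> sAB; apply/subsetP => x; rewrite !mem_closure => rx.
case: (boolP (x \in B)) => xB; first by rewrite (setUidPr _) // sub1set.
have [I [hI sI eI]] := rank_witness A.
have [J [hJ sIJ sJ eJ]] := indep_extend hI (subset_trans sI sAB).
have sJx : J \subset x |: B by apply: subset_trans sJ (subsetUr _ _).
have [K [hK sJK sK eK]] := indep_extend hJ sJx.
case: (boolP (x \in K)) => xK; last first.
  rewrite -eK; apply: rank_max => //; apply/subsetP => z zK.
  move: (subsetP sK z zK); rewrite !inE; case: eqP => // ez.
  by rewrite -ez zK in xK.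
have : #|x |: I| <= rank (x |: A).
  apply: rank_max; last exact: setUS.
  by apply: indepS hK; rewrite subUset sub1set xK (subset_trans sIJ).
have xI : x \notin I.
  by apply: contra xB => xI; rewrite (subsetP sAB) ?(subsetP sI).
by rewrite cardsU1 xI eI => h; have := leq_trans h rx; rewrite add1n ltnn.
Qed.

(** A maximal independent subset I of A cannot be enlarged by an element y of the
closure, since y |: I would be an independent subset of y |: A, whose rank is
that of A. *)
Lemma rank_closure A : rank (closure A) = rank A.
Proof.
apply/eqP; rewrite eqn_leq (rankS (sub_closure A)) andbT leqNgt.
apply/negP => lt.
have [I [hI sI eI]] := rank_witness A.
have [J [hJ sJ eJ]] := rank_witness (closure A).
rewrite -eI -eJ in lt.
have [y] := indep_augment hI hJ lt; rewrite inE => /andP[yI yJ] hyI.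
have : #|y |: I| <= rank (y |: A) by apply: rank_max => //; apply: setUS.
rewrite cardsU1 yI eI add1n ltnNge => /negP; apply.
by rewrite -mem_closure (subsetP sJ).
Qed.

Lemma flat_closure A : flat (closure A).
Proof.
rewrite /flat eqEsubset sub_closure andbT.
apply/subsetP => x; rewrite !mem_closure rank_closure; apply: leq_trans.
by apply: rankS; apply: setUS; apply: sub_closure.
Qed.

Lemma flat_sub A F : flat F -> A \subset F -> closure A \subset F.
Proof. by move=> /eqP eF /closureS; rewrite eF. Qed.

Lemma flatT : flat [set: ground M].
Proof. by rewrite /flat eqEsubset subsetT sub_closure. Qed.

(** Independence in terms of flats alone: x is outside the closure of the rest
of I exactly when some flat separates it from the rest of I. This is what makes
a bijection matching the flats an isomorphism. *)
Lemma indep_flatP I :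
  reflect (forall x, x \in I ->
             exists F, [/\ flat F, I :\ x \subset F & x \notin F])
          (indep I).
Proof.
apply: (iffP idP) => [hI x xI | h].
  exists (closure (I :\ x)); split; [exact: flat_closure|exact: sub_closure|].
  rewrite mem_closure setD1K // -ltnNge !rank_indep //; last first.
    by apply: indepS hI; apply: subD1set.
  by rewrite [X in _ < X](cardsD1 x) xI.
have [J [hJ sJ eJ]] := rank_witness I.
have [/eqP | [x]] := set_0Vmem (I :\: J).
  by rewrite setD_eq0 => sI; apply: indepS hJ.
rewrite inE => /andP[xJ xI]; have [F [hF sF /negP[]]] := h x xI.
apply: (subsetP (flat_sub hF sF)).
rewrite mem_closure setD1K // -eJ; apply: rank_max => //.
by rewrite subsetD1 sJ.
Qed.

End MatroidTheory.

(** * Embeddings of matroids *)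

Definition embedding (N M : matroid) (j : ground N -> ground M) : Prop :=
  injective j /\ forall A : {set ground N}, indep A = indep (j @: A).

Lemma embedding_rank (N M : matroid) (j : ground N -> ground M) :
  embedding j -> forall A, rank A = rank (j @: A).
Proof.
case=> inj_j hj A; apply/eqP; rewrite eqn_leq; apply/andP; split.
  have [I [hI sI <-]] := rank_witness A.
  by rewrite -(card_imset _ inj_j) rank_max -?hj // imsetS.
have [J [hJ sJ <-]] := rank_witness (j @: A).
have [I sI eJ] : exists2 I : {set ground N}, I \subset A & J = j @: I.
  exists (A :&: j @^-1: J); first exact: subsetIl.
  apply/setP => y; apply/idP/imsetP => [yJ|[x]].
    have /imsetP[x xA ey] := subsetP sJ y yJ.
    by exists x; rewrite // !inE xA -ey.
  by rewrite !inE => /andP[_ h] ->.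
by rewrite eJ card_imset // rank_max // hj -eJ.
Qed.

(** An embedding preserves rank, so x lies in the closure of A exactly when its
image lies in the closure of the image of A. A flat G is thus the preimage of
the closure of its image. *)
Lemma embedding_flat (N M : matroid) (j : ground N -> ground M) :
  embedding j -> forall G : {set ground N},
  reflect (exists2 F : {set ground M}, flat F & G = j @^-1: F) (flat G).
Proof.
move=> hj G.
have mem_cl x (A : {set ground N}) :
    (x \in closure A) = (j x \in closure (j @: A)).
  by rewrite !mem_closure !(embedding_rank hj) imsetU1.
apply: (iffP eqP) => [eG | [F hF ->]].
  exists (closure (j @: G)); first exact: flat_closure.
  by apply/setP => x; rewrite [RHS]inE -mem_cl eG.
apply/eqP; rewrite eqEsubset sub_closure andbT.
apply/subsetP => x; rewrite mem_cl => jx; rewrite inE.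
move: (j x) jx; apply/subsetP.
apply: flat_sub => //.
by apply/subsetP => _ /imsetP[z zF ->]; rewrite inE in zF.
Qed.

(** Bases and independent sets determine each other: independent sets are the
subsets of bases, and bases are the independent sets of full rank. *)
Lemma isomorphic_embedding (M N : matroid) :
  isomorphic M N <->
  exists2 f : ground M -> ground N, bijective f & embedding f.
Proof.
split=> -[f bij_f hf]; exists f => //; last first.
  move=> B; rewrite !mem_bases -hf.2 (card_imset _ hf.1) (embedding_rank hf).
  rewrite (_ : f @: setT = setT) //; case: bij_f => g _ gK.
  by apply/setP => y; rewrite inE; apply/imsetP; exists (g y).
split; first exact: bij_inj.
case: (bij_f) => g fK gK A; apply/indepP/indepP => [][B hB sB].
  by exists (f @: B); rewrite -?hf ?imsetS.
have fgB : f @: (g @: B) = B.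
  by rewrite -imset_comp (eq_imset _ gK) imset_id.
exists (g @: B); first by rewrite hf fgB.
by apply/subsetP => x xA; rewrite -(fK x) imset_f // (subsetP sB) ?imset_f.
Qed.

Lemma isomorphic_sym (M N : matroid) : isomorphic M N -> isomorphic N M.
Proof.
case=> f [g fK gK] hf; exists g; first by exists f.
by move=> B; rewrite hf -imset_comp (eq_imset _ gK) imset_id.
Qed.

(** * Pointed matroids and strong maps *)

Section Pointed.
Implicit Types M N : matroid.

Lemma indep_pointed M (A : {set ground (pointed M)}) :
  indep A = (pt M \notin A) &&
            indep ((inl : ground M -> ground (pointed M)) @^-1: A).
Proof.
apply/indepP/andP => [[D /imset2P[B C hB /set1P-> ->] sA]
                     |[pA /indepP[B hB sB]]].
  split.
    by apply/negP => /(subsetP sA); rewrite (@mem_dsum_set_inr M) inE.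
  apply/indepP; exists B => //; apply/subsetP => x; rewrite inE.
  by move=> /(subsetP sA); rewrite mem_dsum_set_inl.
exists (@dsum_set M loop_matroid B set0).
  by apply: imset2_f => //; apply: set11.
apply/subsetP => -[x|[]] xA; last by rewrite xA in pA.
by rewrite mem_dsum_set_inl (subsetP sB) ?inE.
Qed.

(** The distinguished point is a loop, so adding it to a set never increases
the rank. *)
Lemma pt_flat M (F : {set ground (pointed M)}) : flat F -> pt M \in F.
Proof.
move/eqP <-; rewrite mem_closure.
have [I [hI sI <-]] := rank_witness (pt M |: F).
apply: rank_max => //; move: (hI); rewrite indep_pointed => /andP[pI _].
apply/subsetP => z zI; move: (subsetP sI z zI); rewrite !inE.
by case: eqP => // ez; rewrite -ez zI in pI.
Qed.


Definition pmap N M (j : ground N -> ground M) (x : ground (pointed N)) :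
    ground (pointed M) :=
  match x with inl y => inl (j y) | inr u => inr u end.

Lemma pmap_inj N M (j : ground N -> ground M) :
  injective j -> injective (pmap j).
Proof. by move=> inj_j [x|u] [y|v] //= [e]; rewrite ?e ?(inj_j _ _ e). Qed.

Lemma pmap_embedding N M (j : ground N -> ground M) :
  embedding j -> embedding (pmap j).
Proof.
move=> [inj_j hj]; split=> [|A]; first exact: pmap_inj.
rewrite !indep_pointed; congr (~~ _ && _).
  by rewrite -(mem_imset _ _ (pmap_inj inj_j)).
rewrite hj; congr indep; apply/setP => y; rewrite [RHS]inE.
apply/imsetP/imsetP => [[x]|[[x|u] xA //= [->]]].
  by rewrite inE => xA ->; exists (inl x).
by exists x; rewrite ?inE.
Qed.

Lemma inl_embedding M : embedding (inl : ground M -> ground (pointed M)).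
Proof.
split=> [x y []|A] //; rewrite indep_pointed.
rewrite (_ : pt M \notin _); last by apply/imsetP => -[].
by congr indep; apply/setP => x; rewrite inE mem_imset // => ? ? [].
Qed.

Lemma strong_mapP N M (phi : {ffun ground (pointed N) -> ground (pointed M)}) :
  reflect (phi (pt N) = pt M /\
           forall F : {set ground (pointed M)}, flat F -> flat (phi @^-1: F))
          (strong_map phi).
Proof.
apply: (iffP andP) => -[/eqP h1 h2]; split=> //.
  by move=> F hF; apply: (implyP (forallP h2 F)).
by apply/forallP => F; apply/implyP/h2.
Qed.

Lemma strong_comp M N L (phi : {ffun ground (pointed M) -> ground (pointed N)})
    (psi : {ffun ground (pointed N) -> ground (pointed L)}) :
  strong_map phi -> strong_map psi -> strong_map [ffun x => psi (phi x)].
Proof.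
move=> /strong_mapP[p1 h1] /strong_mapP[p2 h2]; apply/strong_mapP.
split=> [|F hF]; first by rewrite ffunE p1 p2.
rewrite (_ : _ @^-1: F = phi @^-1: (psi @^-1: F)); first by apply/h1/h2.
by apply/setP => x; rewrite !inE ffunE.
Qed.

Lemma pmap_strong N M (j : ground N -> ground M) :
  embedding j -> strong_map [ffun x => pmap j x].
Proof.
move=> hj; apply/strong_mapP; split=> [|F hF]; first by rewrite ffunE.
apply/(embedding_flat (pmap_embedding hj)); exists F => //.
by apply/setP => x; rewrite !inE ffunE.
Qed.

Lemma strong_id M : strong_map [ffun x : ground (pointed M) => x].
Proof.
apply/strong_mapP; split=> [|F hF]; first by rewrite ffunE.
by rewrite (_ : _ @^-1: F = F) //; apply/setP => x; rewrite inE ffunE.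
Qed.

Lemma strong_const M N : strong_map [ffun _ : ground (pointed M) => pt N].
Proof.
apply/strong_mapP; split=> [|F hF]; first by rewrite ffunE.
rewrite (_ : _ @^-1: F = setT); first exact: flatT.
by apply/setP => x; rewrite !inE ffunE pt_flat.
Qed.

(** Precomposition with the pointed extension of an isomorphism is injective. *)
Lemma leq_Hom_iso M N L : isomorphic M N -> #|Hom N L| <= #|Hom M L|.
Proof.
move=> /isomorphic_embedding[f [g fK gK] hf].
(* The inner finite function is not unfolded, so that strong_comp applies. *)
pose pre (psi : {ffun ground (pointed N) -> ground (pointed L)}) :=
  [ffun x => psi ([ffun x => pmap f x] x)].
have inj_pre : injective pre.
  move=> p q e; apply/ffunP => y; move/ffunP/(_ (pmap g y)): e.
  by rewrite !ffunE; case: y => [y|u] //=; rewrite gK.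
rewrite -(card_imset _ inj_pre); apply/subset_leq_card.
apply/subsetP => _ /imsetP[p hp ->].
rewrite !inE in hp *; apply: strong_comp hp; exact: pmap_strong.
Qed.

(** * Restriction to a nonempty set *)

Section Restriction.
Variables (L : matroid) (S : {set ground L}).
Hypothesis S_nonempty : S != set0.

Definition restr_ground : finType := {x : ground L | x \in S}.

Definition restr_bases : {set {set restr_ground}} :=
  [set B : {set restr_ground} | indep (val @: B) && (#|B| == rank S)].

Lemma val_restr_sub (A : {set restr_ground}) : val @: A \subset S.
Proof. by apply/subsetP => _ /imsetP[x _ ->]; apply: valP. Qed.

Lemma restr_lift (J : {set ground L}) :
  J \subset S -> exists B : {set restr_ground}, J = val @: B.
Proof.
move=> sJ; exists (val @^-1: J); apply/setP => x.
apply/idP/imsetP => [xJ|[y]]; last by rewrite inE => yJ ->.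
by exists (Sub x (subsetP sJ x xJ)); rewrite ?inE SubK.
Qed.

Lemma restr_ground_nonempty : 0 < #|restr_ground|.
Proof.
by have /set0Pn[x xS] := S_nonempty; apply/card_gt0P; exists (Sub x xS).
Qed.

Lemma restr_extend (A : {set restr_ground}) : indep (val @: A) ->
  exists2 B, B \in restr_bases & A \subset B.
Proof.
move=> hA; have [J [hJ sAJ sJ eJ]] := indep_extend hA (val_restr_sub A).
have [B eB] := restr_lift sJ; exists B.
  by rewrite inE -eB hJ -eJ eB card_imset //=; apply: val_inj.
apply/subsetP => x xA; rewrite -(mem_imset _ _ val_inj) -eB.
by rewrite (subsetP sAJ) ?imset_f.
Qed.

Lemma restr_bases_nonempty : restr_bases != set0.
Proof.
have [|B hB _] := @restr_extend set0; first by rewrite imset0 indep0.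
by apply/set0Pn; exists B.
Qed.

(** B1 :\ x is smaller than B2, so augmentation provides an element of B2 to
add to it; this element is not x, because x is outside B2. *)
Lemma restr_bases_exchange B1 B2 : B1 \in restr_bases -> B2 \in restr_bases ->
  forall x, x \in B1 :\: B2 ->
  exists2 y, y \in B2 :\: B1 & y |: (B1 :\ x) \in restr_bases.
Proof.
rewrite !inE => /andP[h1 /eqP e1] /andP[h2 /eqP e2] x.
rewrite inE => /andP[xB2 xB1].
have hD : indep (val @: (B1 :\ x)).
  by apply: indepS h1; apply: imsetS; apply: subD1set.
have lt : #|val @: (B1 :\ x)| < #|val @: B2|.
  by rewrite !card_imset ?e2 -?e1 ?[X in _ < X](cardsD1 x) ?xB1 //;
    apply: val_inj.
have [_ /setDP[/imsetP[y yB2 ->]]] := indep_augment hD h2 lt.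
rewrite mem_imset; last exact: val_inj.
rewrite !inE negb_and negbK => yD hy.
have yB1 : y \notin B1 by case/orP: yD => // /eqP ey; rewrite -ey yB2 in xB2.
exists y; first by rewrite inE yB1.
by rewrite inE imsetU1 hy card_swap // e1 eqxx.
Qed.

Definition restriction : matroid :=
  Matroid restr_ground_nonempty restr_bases_nonempty restr_bases_exchange.

Lemma restriction_embedding :
  embedding (val : ground restriction -> ground L).
Proof.
split=> [|A]; first exact: val_inj.
apply/idP/idP => [/indepP[B]|/restr_extend[B hB sB]].
  by rewrite inE => /andP[hB _] sB; apply: indepS hB; apply: imsetS.
by apply/indepP; exists B.
Qed.

Lemma image_restriction :
  (val : ground restriction -> ground L) @: setT = S.
Proof.
apply/eqP; rewrite eqEsubset val_restr_sub /=.
by have [B {1}->] := restr_lift (subxx S); apply: imsetS; apply: subsetT.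
Qed.

End Restriction.

(** * Counting strong maps by support *)

Definition supp M L (phi : {ffun ground (pointed M) -> ground (pointed L)}) :
  {set ground L} := [set y | [exists x, phi x == inl y]].

(** Composition with the pointed extension of j identifies the strong maps into
N with the strong maps into L that take their values in its image: such a map
factors through j pointwise, and the factor is strong because every flat of the
pointed N is the preimage of a flat of the pointed L. *)
Lemma card_Hom_embedding M N L (j : ground N -> ground L) : embedding j ->
  #|[set phi in Hom M L | supp phi \subset j @: setT]| = #|Hom M N|.
Proof.
move=> hj; have inj_pj := pmap_inj hj.1.
pose post (psi : {ffun ground (pointed M) -> ground (pointed N)}) :=
  [ffun x => [ffun y => pmap j y] (psi x)].
have inj_post : injective post.
  move=> p q /ffunP e; apply/ffunP => x; move: (e x).
  by rewrite !ffunE => /inj_pj.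
rewrite -(card_imset _ inj_post); apply: eq_card => phi; rewrite !inE.
apply/andP/imsetP => [[/strong_mapP[p1 h1] sphi] | [psi]]; last first.
  rewrite inE => hpsi ->; split; first exact/strong_comp/pmap_strong.
  apply/subsetP => y; rewrite inE => /existsP[x]; rewrite !ffunE.
  by case: (psi x) => [z|u] //= /eqP[<-]; apply: imset_f.
have [x|g hg] := @fin_all_exists _ _ (fun x z => pmap j z = phi x).
  case ex: (phi x) => [y|[]]; last by exists (inr tt).
  have /imsetP[z _ ->] : y \in j @: setT.
    by apply: (subsetP sphi); rewrite inE; apply/existsP; exists x; rewrite ex.
  by exists (inl z).
exists (finfun g); last by apply/ffunP => x; rewrite !ffunE hg.
rewrite inE; apply/strong_mapP; split=> [|G].
  by apply: inj_pj; rewrite ffunE hg p1.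
case/(embedding_flat (pmap_embedding hj)) => F hF ->.
rewrite (_ : _ @^-1: _ = phi @^-1: F); first exact: h1.
by apply/setP => x; rewrite !inE ffunE hg.
Qed.

Lemma card_Hom_supp0 M L :
  #|[set phi in Hom M L | supp phi \subset set0]| = 1.
Proof.
rewrite -(cards1 [ffun _ : ground (pointed M) => pt L]); apply: eq_card => phi.
rewrite !inE subset0; apply/andP/eqP => [[_ /eqP s0] | ->].
  apply/ffunP => x; rewrite ffunE; case ex: (phi x) => [y|[]] //.
  by move/setP/(_ y): s0; rewrite !inE => /existsP[]; exists x; rewrite ex.
split; first exact: strong_const.
by apply/eqP/setP => y; rewrite !inE; apply/existsP => -[x]; rewrite ffunE.
Qed.

Lemma card_Hom_supp_sum M L (S : {set ground L}) :
  #|[set phi in Hom M L | supp phi \subset S]| =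
  #|[set phi in Hom M L | supp phi == S]| +
    \sum_(T : {set ground L} | T \proper S)
      #|[set phi in Hom M L | supp phi == T]|.
Proof.
rewrite -sum1_card (partition_big (@supp M L) (fun T => T \subset S)) /=;
  last by move=> phi; rewrite !inE => /andP[].
rewrite (bigD1 S) ?subxx //=; congr (_ + _).
  rewrite -sum1_card; apply: eq_bigl => phi; rewrite !inE -andbA.
  by case: eqP => [->|]; rewrite ?subxx ?andbF.
apply: eq_big => [T|T /andP[sT _]]; first by rewrite properEneq andbC.
rewrite -sum1_card; apply: eq_bigl => phi; rewrite !inE -andbA.
by case: eqP => [->|]; rewrite ?sT ?andbF.
Qed.

(** Inclusion-exclusion by induction on #|S|: the strong maps with support inside
S are counted by the Hom set into the restriction to S, or there is just one of
them if S is empty, and those whose support is a proper subset of S are equally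
many by induction. *)
Lemma card_Hom_supp_eq M1 M2 L (S : {set ground L}) :
  (forall N, #|Hom M1 N| = #|Hom M2 N|) ->
  #|[set phi in Hom M1 L | supp phi == S]| =
  #|[set phi in Hom M2 L | supp phi == S]|.
Proof.
move=> eqH; move: {2}_.+1 (ltnSn #|S|) => n.
elim: n S => // n IHn S ltn.
have : #|[set phi in Hom M1 L | supp phi \subset S]| =
       #|[set phi in Hom M2 L | supp phi \subset S]|.
  have [->|S0] := eqVneq S set0; first by rewrite !card_Hom_supp0.
  rewrite -(image_restriction S0).
  by rewrite !(card_Hom_embedding _ (restriction_embedding S0)).
rewrite !card_Hom_supp_sum.
rewrite [X in _ + X](eq_bigr
  (fun T => #|[set phi in Hom M2 L | supp phi == T]|)).
  by move/addIn.
by move=> T /proper_card ltT; apply: IHn; apply: leq_trans ltT _.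
Qed.

(** The identity of M1 has full support, so some strong map from M2 also has; it
is surjective because strong maps preserve the distinguished point. *)
Lemma strong_surjection M1 M2 : (forall N, #|Hom M1 N| = #|Hom M2 N|) ->
  exists phi : {ffun ground (pointed M2) -> ground (pointed M1)},
    strong_map phi /\ forall y, exists x, phi x = y.
Proof.
move=> eqH.
have : 0 < #|[set phi in Hom M1 M1 | supp phi == setT]|.
  apply/card_gt0P; exists [ffun x => x]; rewrite !inE strong_id /=.
  by apply/eqP/setP => y; rewrite !inE; apply/existsP; exists (inl y);
    rewrite ffunE.
rewrite (card_Hom_supp_eq _ eqH) => /card_gt0P[phi].
rewrite !inE => /andP[hphi /eqP sphi]; exists phi; split=> // -[y|[]].
  have : y \in supp phi by rewrite sphi.
  by rewrite inE => /existsP[x /eqP]; exists x.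
by exists (pt M2); have [] := strong_mapP _ hphi.
Qed.

(** * From strong surjections to an isomorphism *)

(** Preimage under a surjection is injective on sets, so each strong surjection
injects the flats of its target into the flats of its source. With one
surjection in each direction, all these injections between finite sets are
bijections. *)
Lemma strong_surjections_flat M N
    (phi : {ffun ground (pointed M) -> ground (pointed N)})
    (psi : {ffun ground (pointed N) -> ground (pointed M)}) :
  strong_map phi -> (forall y, exists x, phi x = y) ->
  strong_map psi -> (forall y, exists x, psi x = y) ->
  bijective phi /\
  forall F : {set ground (pointed N)}, flat F = flat (phi @^-1: F).
Proof.
pose pre A B (f : ground (pointed A) -> ground (pointed B))
  (F : {set ground (pointed B)}) := f @^-1: F.
have flats A B (f : {ffun ground (pointed A) -> ground (pointed B)}) :
    strong_map f -> (forall y, exists x, f x = y) ->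
    [/\ #|ground (pointed B)| <= #|ground (pointed A)|,
        injective (pre A B f) &
        pre A B f @: [set F | @flat (pointed B) F] \subset
        [set F | @flat (pointed A) F]].
  move=> /strong_mapP[_ hf] sf; split.
  - have [g gK] := fin_all_exists sf.
    exact: leq_card (can_inj gK).
  - move=> F G /setP e; apply/setP => y; have [x <-] := sf y.
    by move: (e x); rewrite !inE.
  - by apply/subsetP => _ /imsetP[F hF ->]; move: hF; rewrite !inE; apply: hf.
move=> hphi sphi hpsi spsi.
have [c1 i1 s1] := flats _ _ _ hphi sphi.
have [c2 i2 s2] := flats _ _ _ hpsi spsi.
split.
  have [g gK] := fin_all_exists sphi.
  have [g' _ g'K] := inj_card_bij (can_inj gK) c2.
  by exists g => // x; rewrite -{1}[x]g'K gK g'K.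
have e : pre M N phi @: [set F | @flat (pointed N) F] =
         [set F | @flat (pointed M) F].
  apply/eqP; rewrite eqEcard s1 card_imset //.
  by have := subset_leq_card s2; rewrite card_imset.
move=> F; have := mem_imset [set F | @flat (pointed N) F] F i1.
by rewrite e !inE.
Qed.

(** [indep_flatP] describes independence by flats alone, so it is carried along by
a bijection that matches the flats. *)
Lemma flat_bij_embedding (M N : matroid) (f : ground M -> ground N) :
  bijective f -> (forall F : {set ground N}, flat F = flat (f @^-1: F)) ->
  embedding f.
Proof.
move=> bij_f hf; split=> [|A]; first exact: bij_inj.
case: (bij_f) => g fK gK; have inj_f := can_inj fK.
apply/indep_flatP/indep_flatP => [h _ /imsetP[x xA ->] | h x xA].
  have [F [hF sF xF]] := h x xA.
  have eF : F = f @^-1: (g @^-1: F) by apply/setP => z; rewrite !inE fK.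
  exists (g @^-1: F); split; [by rewrite hf -eF| |by rewrite inE fK].
  apply/subsetP => y; rewrite !inE => /andP[yx /imsetP[z zA ey]].
  by rewrite ey fK (subsetP sF) // !inE zA andbT -(inj_eq inj_f) -ey.
have [F [hF sF xF]] := h (f x) (imset_f _ xA).
exists (f @^-1: F); split; rewrite -?hf ?inE //.
apply/subsetP => z; rewrite !inE => /andP[zx zA].
by rewrite (subsetP sF) // !inE (inj_eq inj_f) zx imset_f.
Qed.

(** By injectivity only the distinguished point is sent to the distinguished
point, so f restricts to a bijection of the underlying ground sets. *)
Lemma pointed_isomorphic M N (f : ground (pointed M) -> ground (pointed N)) :
  bijective f -> embedding f -> f (pt M) = pt N -> isomorphic M N.
Proof.
move=> bij_f hf fpt; apply/isomorphic_embedding.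
have [x|f0 ef0] := @fin_all_exists _ _ (fun x y => f (inl x) = inl y).
  case ex: (f (inl x)) => [y|[]]; first by exists y.
  by move: ex; rewrite -[inr tt]/(pt N) -fpt => /hf.1.
have inj_f0 : injective f0.
  move=> x y e; have : f (inl x) = f (inl y) by rewrite !ef0 e.
  by move/hf.1 => -[].
exists f0.
  apply: inj_card_bij inj_f0 _.
  have := bij_eq_card bij_f.
  by rewrite !card_sum => /addIn ->.
split=> // A; rewrite (inl_embedding M).2 (inl_embedding N).2 hf.2 -!imset_comp.
by congr indep; apply: eq_imset => x /=; rewrite ef0.
Qed.

End Pointed.

Theorem theorem6p3 (M1 M2 : matroid) :
  isomorphic M1 M2 <->
  (forall L : matroid, #|Hom M1 L| = #|Hom M2 L|).
Proof.
split=> [iso L | eqH].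
  by apply/eqP; rewrite eqn_leq !leq_Hom_iso //; apply: isomorphic_sym.
have [psi [hpsi spsi]] := strong_surjection eqH.
have [phi [hphi sphi]] := strong_surjection (fun L => esym (eqH L)).
have [bij_phi flat_phi] := strong_surjections_flat hphi sphi hpsi spsi.
apply: (pointed_isomorphic bij_phi (flat_bij_embedding bij_phi flat_phi)).
by have [] := strong_mapP _ hphi.
Qed.
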